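(* Let $(L,\omega)$ be an $A$-anchored Lie algebra and let $\mathcal{B}_L = A\odot U_{\Bbbk}(L)\odot A$, regarded as an $A^e$-ring, together with the Lie algebra morphism $J_L:L\to\mathcal{L}(\mathcal{B}_L)$, $X\mapsto 1_A\otimes x\otimes 1_A$. Given an $A^e$-ring $\mathcal{R}$ with $\Bbbk$-algebra morphism $\phi_A:A^e\to\mathcal{R}$ and given a Lie algebra morphism $\phi_L:L\to\mathcal{L}(\mathcal{R})$ such that $$\big[\phi_L(X),\phi_A(a\otimes b^o)\big]=\phi_A\big(X\cdot(a\otimes b^o)\big)$$ for all $a,b\in A$ and all $X\in L$, there exists a unique morphism of $A^e$-rings $\Phi:\mathcal{B}_L\to\mathcal{R}$ such that $\Phi\circ J_L=\phi_L$. It is explicitly given by $$\Phi:\mathcal{B}_L\to\mathcal{R},\qquad a\otimes u\otimes b\mapsto\phi_A(a\otimes b^o)\,\phi'(u),$$ where $\phi':U_{\Bbbk}(L)\to\mathcal{R}$ is the unique morphism of $\Bbbk$-algebras such that $\phi'\circ j_L=\phi_L$.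
   Context: $\Bbbk$ is a field of characteristic $0$, $\otimes=\otimes_{\Bbbk}$, $A$ is a (possibly non-commutative) associative unital $\Bbbk$-algebra, $A^o$ is the opposite algebra (with elements written $a^o$), and $A^e=A\otimes A^o$. An $A^e$-ring is a $\Bbbk$-algebra $\mathcal{R}$ with a $\Bbbk$-algebra morphism $A^e\to\mathcal{R}$; a morphism of $A^e$-rings is a $\Bbbk$-algebra morphism compatible with the maps from $A^e$. For an associative algebra $R$, $\mathcal{L}(R)$ is $R$ with the commutator bracket. An $A$-anchored Lie algebra is a Lie algebra $L$ over $\Bbbk$ with a Lie algebra morphism $\omega:L\to\mathrm{Der}_{\Bbbk}(A)$ (the anchor); write $X\cdot a=\omega(X)(a)$ and $X\cdot(a\otimes b^o)=(X\cdot a)\otimes b^o+a\otimes(X\cdot b)^o$. $U_{\Bbbk}(L)$ is the universal enveloping algebra with its usual Hopf algebra structure, $\Delta(u)=\sum u_{(1)}\otimes u_{(2)}$, and $j_L:L\to U_{\Bbbk}(L)$, $X\mapsto x$, is the canonical map. The anchor extends uniquely to an algebra map $\Omega:U_{\Bbbk}(L)\to\mathrm{End}_{\Bbbk}(A)$, and $u\cdot a=\Omega(u)(a)$ makes $A$ a $U_{\Bbbk}(L)$-module algebra. $\mathcal{B}_L=A\odot U_{\Bbbk}(L)\odot A$ is the vector space $A\otimes U_{\Bbbk}(L)\otimes A$ with product $$(a\otimes u\otimes b)(a'\otimes v\otimes b')=\sum a(u_{(1)}\cdot a')\otimes u_{(2)}v\otimes(u_{(3)}\cdot b')b$$ and unit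 $1_A\otimes1\otimes1_A$; it is an $A^e$-ring via $a\otimes b^o\mapsto a\otimes1\otimes b$. *)

(* Defs.v *)
From HB Require Import structures.
From mathcomp Require Import all_boot all_algebra generic_quotient.
From mathcomp Require Import boolp classical_sets functions.

Set Implicit Arguments.
Unset Strict Implicit.
Unset Printing Implicit Defensive.

Import GRing.Theory.
Local Open Scope ring_scope.

(* k-algebras are [algType k], hence nonzero: [GRing.oner_neq0] is part of that
   structure. [ex_functional] and [pure_neq0] below serve to show that tensor
   products of such algebras are again nonzero. *)

HB.mixin Record Lmodule_isLieAlgebra (k : pzRingType) L
    of GRing.Lmodule k L := {
  lie : L -> L -> L;
  lie_linearl : forall y, linear (lie^~ y);
  lie_linearr : forall x, linear (lie x);
  liexx : forall x, lie x x = 0;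
  lie_jacobi : forall x y z,
    lie x (lie y z) + lie y (lie z x) + lie z (lie x y) = 0
}.

#[short(type="lieAlgType")]
HB.structure Definition LieAlgebra (k : pzRingType) :=
  {L of GRing.Lmodule k L & Lmodule_isLieAlgebra k L}.

HB.mixin Record isLieMorphism (k : pzRingType) (L M : lieAlgType k)
    (f : L -> M) := {
  lie_morph : forall x y, f (lie x y) = lie (f x) (f y)
}.

HB.structure Definition LieMorphism (k : pzRingType) (L M : lieAlgType k) :=
  {f of @GRing.Linear k L M *:%R f & isLieMorphism k L M f}.

Notation "{ 'liemorph' L -> M }" := (@LieMorphism.type _ L%type M%type)
  (at level 0, L at level 98, M at level 99,
   format "{ 'liemorph'  L  ->  M }") : type_scope.


Section CommutatorLie.

Lemma jacobi_cancel (V : zmodType) (a b c d e f : V) :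
  (a - b - (c - d)) + (c - e - (f - b)) + (f - d - (a - e)) = 0.
Proof.
rewrite !opprB !addrA.
rewrite [LHS](ACl ((1*12)*(7*2)*(3*10)*(5*4)*(11*6)*(9*8))) /=.
by rewrite !subrr !addr0.
Qed.

Variables (k : fieldType) (R : algType k).
Implicit Types x y z : R.

Definition commutator x y : R := x * y - y * x.

Lemma commutator_linearl y : linear (commutator^~ y).
Proof.
move=> c u v; rewrite /commutator mulrDl mulrDr -scalerAl -scalerAr.
by rewrite opprD addrACA scalerBr.
Qed.

Lemma commutator_linearr x : linear (commutator x).
Proof.
move=> c u v; rewrite /commutator mulrDl mulrDr -scalerAl -scalerAr.
by rewrite opprD addrACA scalerBr.
Qed.

Lemma commutatorxx x : commutator x x = 0.
Proof. exact: subrr. Qed.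

Lemma commutator_jacobi x y z :
  commutator x (commutator y z) + commutator y (commutator z x)
    + commutator z (commutator x y) = 0.
Proof.
rewrite /commutator !mulrBr !mulrBl !mulrA.
exact: jacobi_cancel.
Qed.

End CommutatorLie.

(* The Lie algebra L(R): the vector space R with the commutator bracket. *)
Definition comm_lie (R : Type) : Type := R.

HB.instance Definition _ (k : fieldType) (R : algType k) :=
  GRing.Lmodule.copy (comm_lie R) R.
HB.instance Definition _ (k : fieldType) (R : algType k) :=
  Lmodule_isLieAlgebra.Build k (comm_lie R)
    (@commutator_linearl k R) (@commutator_linearr k R)
    (@commutatorxx k R) (@commutator_jacobi k R).

Section Endomorphisms.
Variables (k : fieldType) (V : lmodType k).

Record kEnd := KEnd { kEnd_fun :> V -> V; _ : `[< linear kEnd_fun >] }.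

HB.instance Definition _ := [isSub for kEnd_fun].
HB.instance Definition _ := [Choice of kEnd by <:].

Lemma kEnd_linear (f : kEnd) : linear f.
Proof. by case: f => f fP /=; apply: asboolW fP. Qed.

HB.instance Definition _ (f : kEnd) :=
  GRing.isLinear.Build k V V *:%R (kEnd_fun f) (kEnd_linear f).

Lemma kEnd_ext (f g : kEnd) : f =1 g -> f = g.
Proof. by move=> fg; apply: val_inj; apply: funext. Qed.

Fact kEnd_closed : subsemimod_closed (fun f : V -> V => `[< linear f >]).
Proof.
split; first split.
- apply/asboolP => c u v /=; by rewrite /= scaler0 addr0.
- move=> f g /asboolP lf /asboolP lg; apply/asboolP => c u v /=.
  by rewrite !addrfctE lf lg scalerDr addrACA.
- move=> a f /asboolP lf; apply/asboolP => c u v /=.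
  by rewrite !scalrfctE lf scalerDr !scalerA mulrC.
Qed.

HB.instance Definition _ :=
  GRing.SubChoice_isSubLmodule.Build k (V -> V)
    (fun f : V -> V => `[< linear f >]) kEnd kEnd_closed.

End Endomorphisms.

Section EndAlgebra.
Variables (k : fieldType) (A : algType k).
Local Notation E := (kEnd A).

Fact kEnd_one_subproof : `[< linear (@idfun A) >].
Proof. exact/asboolP. Qed.
Definition kEnd_one : E := KEnd kEnd_one_subproof.

Fact kEnd_mul_subproof (f g : E) : `[< linear (f \o g) >].
Proof. by apply/asboolP => c u v /=; rewrite !kEnd_linear. Qed.
Definition kEnd_mul (f g : E) : E := KEnd (kEnd_mul_subproof f g).

Lemma kEnd_addE (f g : E) x : (f + g) x = f x + g x. Proof. by []. Qed.
Lemma kEnd_scaleE c (f : E) x : (c *: f) x = c *: f x. Proof. by []. Qed.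

Fact kEnd_mulA : associative kEnd_mul.
Proof. by move=> f g h; apply: kEnd_ext. Qed.
Fact kEnd_mul1 : left_id kEnd_one kEnd_mul.
Proof. by move=> f; apply: kEnd_ext. Qed.
Fact kEnd_mulr1 : right_id kEnd_one kEnd_mul.
Proof. by move=> f; apply: kEnd_ext. Qed.
Fact kEnd_mulDl : left_distributive kEnd_mul +%R.
Proof. by move=> f g h; apply: kEnd_ext. Qed.
Fact kEnd_mulDr : right_distributive kEnd_mul +%R.
Proof.
by move=> f g h; apply: kEnd_ext => x; apply: (linearD f).
Qed.
Fact kEnd_one_neq0 : kEnd_one != 0.
Proof.
apply/eqP => /(congr1 (fun f : E => f 1)) /= /eqP.
by rewrite (oner_eq0 A).
Qed.

HB.instance Definition _ := GRing.Zmodule_isNzRing.Build (kEnd A)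
  kEnd_mulA kEnd_mul1 kEnd_mulr1 kEnd_mulDl kEnd_mulDr kEnd_one_neq0.

Fact kEnd_scalerAl (c : k) (f g : E) : c *: (f * g) = (c *: f) * g.
Proof. exact: kEnd_ext. Qed.
HB.instance Definition _ := GRing.Lmodule_isLalgebra.Build k (kEnd A)
  kEnd_scalerAl.
Fact kEnd_scalerAr (c : k) (f g : E) : c *: (f * g) = f * (c *: g).
Proof.
by apply: kEnd_ext => x; rewrite -[RHS]/(f (c *: g x)) linearZ.
Qed.
HB.instance Definition _ := GRing.Lalgebra_isAlgebra.Build k (kEnd A)
  kEnd_scalerAr.

Lemma kEnd_mulE (f g : E) x : (f * g) x = f (g x). Proof. by []. Qed.
Lemma kEnd_oneE x : (1 : E) x = x. Proof. by []. Qed.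

End EndAlgebra.

Section Derivations.
Variables (k : fieldType) (A : algType k).

Definition is_derivation (f : A -> A) : Prop :=
  linear f /\ forall a b, f (a * b) = f a * b + a * f b.

Record Der := MkDer { Der_fun :> A -> A; _ : `[< is_derivation Der_fun >] }.

HB.instance Definition _ := [isSub for Der_fun].
HB.instance Definition _ := [Choice of Der by <:].

Lemma DerP (D : Der) : is_derivation D.
Proof. by case: D => f fP /=; apply: asboolW fP. Qed.

HB.instance Definition _ (D : Der) :=
  GRing.isLinear.Build k A A *:%R (Der_fun D) (DerP D).1.

Lemma DerM (D : Der) a b : D (a * b) = D a * b + a * D b.
Proof. exact: (DerP D).2. Qed.

Lemma Der1 (D : Der) : D 1 = 0.
Proof.
by apply: (@addrI _ (D 1)); rewrite addr0 -[RHS](congr1 D (mulr1 1)) DerM mulr1 mul1r.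
Qed.

Lemma Der_ext (D D' : Der) : D =1 D' -> D = D'.
Proof. by move=> fg; apply: val_inj; apply: funext. Qed.

Fact Der_closed : subsemimod_closed (fun f : A -> A => `[< is_derivation f >]).
Proof.
split; first split.
- apply/asboolP; split=> [c u v|a b] /=; first by rewrite /= scaler0 addr0.
  by rewrite mul0r mulr0 addr0.
- move=> f g /asboolP[lf mf] /asboolP[lg mg]; apply/asboolP.
  split=> [c u v|a b] /=; first by rewrite !addrfctE lf lg scalerDr addrACA.
  by rewrite !addrfctE mf mg mulrDl mulrDr addrACA.
- move=> a f /asboolP[lf mf]; apply/asboolP.
  split=> [c u v|b c] /=; rewrite !scalrfctE.
    by rewrite lf scalerDr !scalerA mulrC.
  by rewrite mf scalerDr scalerAl scalerAr.
Qed.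

HB.instance Definition _ :=
  GRing.SubChoice_isSubLmodule.Build k (A -> A)
    (fun f : A -> A => `[< is_derivation f >]) Der Der_closed.

Fact Der_lie_subproof (D D' : Der) :
  `[< is_derivation (fun a => D (D' a) - D' (D a)) >].
Proof.
apply/asboolP; split=> [c u v|a b] /=.
  by rewrite !linearP /= addrACA -scalerDr.
rewrite (DerM D') (DerM D) [D (_ + _)]linearD [D' (_ + _)]linearD /= !DerM.
rewrite mulrBl mulrBr.
rewrite !opprD !addrA.
rewrite [LHS](ACl ((1*5)*(4*8)*((3*6)*(2*7)))) /=.
by rewrite !subrr !addr0 !addrA.
Qed.

Definition Der_lie (D D' : Der) : Der := MkDer (Der_lie_subproof D D').

Fact Der_lie_linearl D' : linear (Der_lie^~ D').
Proof.
move=> c D1 D2; apply: Der_ext => a.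
rewrite -[LHS]/(c *: D1 (D' a) + D2 (D' a) - D' (c *: D1 a + D2 a)) linearP.
by rewrite opprD addrACA -scalerBr.
Qed.

Fact Der_lie_linearr D : linear (Der_lie D).
Proof.
move=> c D1 D2; apply: Der_ext => a.
rewrite -[LHS]/(D (c *: D1 a + D2 a) - (c *: D1 (D a) + D2 (D a))) linearP.
by rewrite opprD addrACA -scalerBr.
Qed.

Fact Der_liexx D : Der_lie D D = 0.
Proof. by apply: Der_ext => a; apply: subrr. Qed.

Fact Der_lie_jacobi D1 D2 D3 :
  Der_lie D1 (Der_lie D2 D3) + Der_lie D2 (Der_lie D3 D1)
    + Der_lie D3 (Der_lie D1 D2) = 0.
Proof.
apply: Der_ext => a.
rewrite -[RHS]/(0 : A) -[RHS](@jacobi_cancel A (D1 (D2 (D3 a)))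
  (D1 (D3 (D2 a))) (D2 (D3 (D1 a))) (D3 (D2 (D1 a)))
  (D2 (D1 (D3 a))) (D3 (D1 (D2 a)))).
by congr (_ + _ + _); rewrite -[LHS]/(_ - _); congr (_ - _); rewrite /= linearB.
Qed.

HB.instance Definition _ := Lmodule_isLieAlgebra.Build k Der
  Der_lie_linearl Der_lie_linearr Der_liexx Der_lie_jacobi.

Lemma Der_lieE (D D' : Der) a : (lie D D') a = D (D' a) - D' (D a).
Proof. by []. Qed.

Definition Der_End (D : Der) : kEnd A := KEnd (asboolT (DerP D).1).

End Derivations.

(* M (x)_k N by generators [t_pure m n] and relations: the formal expressions
   modulo the least congruence making the quotient a vector space and
   [t_pure] bilinear. *)
Section TensorProduct.
Variables (k : fieldType) (M N : lmodType k).

Inductive tterm :=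
| t_pure of M & N
| t_zero
| t_add of tterm & tterm
| t_scale of k & tterm.

Inductive teq : tterm -> tterm -> Prop :=
| teq_refl s : teq s s
| teq_sym s t : teq s t -> teq t s
| teq_trans s t u : teq s t -> teq t u -> teq s u
| teq_add s s' t t' : teq s s' -> teq t t' -> teq (t_add s t) (t_add s' t')
| teq_scale c s s' : teq s s' -> teq (t_scale c s) (t_scale c s')
| teq_addA s t u : teq (t_add s (t_add t u)) (t_add (t_add s t) u)
| teq_addC s t : teq (t_add s t) (t_add t s)
| teq_add0 s : teq (t_add t_zero s) s
| teq_scaleA c d s : teq (t_scale c (t_scale d s)) (t_scale (c * d) s)
| teq_scale0 s : teq (t_scale 0 s) t_zero
| teq_scale1 s : teq (t_scale 1 s) s
| teq_scaleDr c s t :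
    teq (t_scale c (t_add s t)) (t_add (t_scale c s) (t_scale c t))
| teq_scaleDl c d s :
    teq (t_scale (c + d) s) (t_add (t_scale c s) (t_scale d s))
| teq_pureDl m m' n :
    teq (t_pure (m + m') n) (t_add (t_pure m n) (t_pure m' n))
| teq_pureDr m n n' :
    teq (t_pure m (n + n')) (t_add (t_pure m n) (t_pure m n'))
| teq_pureZl c m n : teq (t_pure (c *: m) n) (t_scale c (t_pure m n))
| teq_pureZr c m n : teq (t_pure m (c *: n)) (t_scale c (t_pure m n)).

HB.instance Definition _ := gen_eqMixin tterm.
HB.instance Definition _ := gen_choiceMixin tterm.

Definition teqb (s t : tterm) : bool := `[< teq s t >].

Fact teqb_refl : reflexive teqb.
Proof. by move=> s; apply/asboolP; constructor. Qed.
Fact teqb_sym : symmetric teqb.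
Proof. by move=> s t; apply/asboolP/asboolP => /teq_sym. Qed.
Fact teqb_trans : transitive teqb.
Proof.
by move=> t s u /asboolP st /asboolP tu; apply/asboolP; apply: teq_trans st tu.
Qed.

Canonical teqb_equiv := EquivRel teqb teqb_refl teqb_sym teqb_trans.

Definition tens := {eq_quot teqb}%qT.
HB.instance Definition _ := Choice.on tens.

Definition tclass (s : tterm) : tens := \pi_tens%qT s.
Definition tterm_of (x : tens) : tterm := repr x.

Lemma tterm_ofK x : tclass (tterm_of x) = x.
Proof. exact: reprK. Qed.

Lemma tclassP s t : tclass s = tclass t <-> teq s t.
Proof.
split; first by move/eqmodP/asboolP.
by move=> st; apply/eqmodP/asboolP.
Qed.

Lemma tclassK s : teq (tterm_of (tclass s)) s.
Proof. by apply/tclassP; rewrite tterm_ofK. Qed.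

Definition tzero : tens := tclass t_zero.
Definition tadd (x y : tens) := tclass (t_add (tterm_of x) (tterm_of y)).
Definition tscale c (x : tens) := tclass (t_scale c (tterm_of x)).

Lemma taddE s t : tadd (tclass s) (tclass t) = tclass (t_add s t).
Proof. by apply/tclassP; apply: teq_add; apply: tclassK. Qed.
Lemma tscaleE c s : tscale c (tclass s) = tclass (t_scale c s).
Proof. by apply/tclassP; apply: teq_scale; apply: tclassK. Qed.

Lemma tclass_surj x : exists s, x = tclass s.
Proof. by exists (tterm_of x); rewrite tterm_ofK. Qed.

Fact taddA : associative tadd.
Proof.
move=> x y z; have [s ->] := tclass_surj x; have [t ->] := tclass_surj y.
have [u ->] := tclass_surj z; rewrite !taddE; apply/tclassP.
exact: teq_addA.
Qed.
Fact taddC : commutative tadd.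
Proof.
move=> x y; have [s ->] := tclass_surj x; have [t ->] := tclass_surj y.
by rewrite !taddE; apply/tclassP; apply: teq_addC.
Qed.
Fact tadd0 : left_id tzero tadd.
Proof.
move=> x; have [s ->] := tclass_surj x.
by rewrite !taddE; apply/tclassP; apply: teq_add0.
Qed.
HB.instance Definition _ := GRing.isNmodule.Build tens taddA taddC tadd0.

Fact tscaleA c d x : tscale c (tscale d x) = tscale (c * d) x.
Proof.
have [s ->] := tclass_surj x.
by rewrite !tscaleE; apply/tclassP; apply: teq_scaleA.
Qed.
Fact tscale0 x : tscale 0 x = 0.
Proof.
have [s ->] := tclass_surj x.
by rewrite !tscaleE; apply/tclassP; apply: teq_scale0.
Qed.
Fact tscale1 : left_id 1 tscale.
Proof.
move=> x; have [s ->] := tclass_surj x.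
by rewrite !tscaleE; apply/tclassP; apply: teq_scale1.
Qed.
Fact tscaleDr : right_distributive tscale +%R.
Proof.
move=> c x y; have [s ->] := tclass_surj x; have [t ->] := tclass_surj y.
rewrite /GRing.add /= !(taddE, tscaleE); apply/tclassP; exact: teq_scaleDr.
Qed.
Fact tscaleDl x : {morph tscale^~ x : c d / c + d}.
Proof.
move=> c d; have [s ->] := tclass_surj x.
rewrite /GRing.add /= !(taddE, tscaleE); apply/tclassP; exact: teq_scaleDl.
Qed.

HB.instance Definition _ := GRing.Nmodule_isLSemiModule.Build k tens
  tscaleA tscale0 tscale1 tscaleDr tscaleDl.
HB.instance Definition _ := GRing.LSemiModule_isLmodule.Build k tens.

Definition pure (m : M) (n : N) : tens := tclass (t_pure m n).

Lemma tens_ind (P : tens -> Prop) :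
  (forall m n, P (pure m n)) -> P 0 ->
  (forall x y, P x -> P y -> P (x + y)) ->
  (forall c x, P x -> P (c *: x)) -> forall x, P x.
Proof.
move=> Pp P0 Pa Ps x; have [s ->] := tclass_surj x.
elim: s => [m n||s Hs t Ht|c s Hs].
- exact: Pp.
- exact: P0.
- by rewrite -taddE; apply: Pa.
- by rewrite -tscaleE; apply: Ps.
Qed.

Lemma pure_linearl n : linear (pure^~ n).
Proof.
move=> c m m'; rewrite /pure.
have -> : c *: tclass (t_pure m n) = tclass (t_scale c (t_pure m n)).
  exact: tscaleE.
rewrite -[RHS]/(tadd _ _) taddE; apply/tclassP.
apply: teq_trans (teq_pureDl _ _ _) _.
apply: teq_add (teq_pureZl _ _ _) (teq_refl _).
Qed.

Lemma pure_linearr m : linear (pure m).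
Proof.
move=> c n n'; rewrite /pure.
have -> : c *: tclass (t_pure m n) = tclass (t_scale c (t_pure m n)).
  exact: tscaleE.
rewrite -[RHS]/(tadd _ _) taddE; apply/tclassP.
apply: teq_trans (teq_pureDr _ _ _) _.
apply: teq_add (teq_pureZr _ _ _) (teq_refl _).
Qed.

Section Lift.
Variable W : lmodType k.

Fixpoint teval (f : M -> N -> W) (s : tterm) : W :=
  match s with
  | t_pure m n => f m n
  | t_zero => 0
  | t_add s t => teval f s + teval f t
  | t_scale c s => c *: teval f s
  end.

Definition is_bilinear (f : M -> N -> W) : Prop :=
  (forall n, linear (f^~ n)) /\ (forall m, linear (f m)).

(* The linear map induced by [f]; meaningful only for bilinear [f], see
   [tliftE] and [tlift_linear]. *)
Definition tlift (f : M -> N -> W) (x : tens) : W := teval f (tterm_of x).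

Lemma linear_fun0 (U V : lmodType k) (f : U -> V) : linear f -> f 0 = 0.
Proof.
by move=> lf; have := lf (-1) 0 0; rewrite scaler0 addr0 scaleN1r addNr.
Qed.
Lemma linear_funD (U V : lmodType k) (f : U -> V) x y :
  linear f -> f (x + y) = f x + f y.
Proof. by move=> lf; have := lf 1 x y; rewrite !scale1r. Qed.
Lemma linear_funZ (U V : lmodType k) (f : U -> V) c x :
  linear f -> f (c *: x) = c *: f x.
Proof.
by move=> lf; have := lf c x 0; rewrite (linear_fun0 lf) !addr0.
Qed.

Lemma teval_eq f s t : is_bilinear f -> teq s t -> teval f s = teval f t.
Proof.
move=> [fl fr]; elim=> //=.
- by move=> ? ? ? _ -> _ ->.
- by move=> ? ? ? ? _ -> _ ->.
- by move=> ? ? ? _ ->.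
- by move=> *; rewrite addrA.
- by move=> *; rewrite addrC.
- by move=> *; rewrite add0r.
- by move=> *; rewrite scalerA.
- by move=> *; rewrite scale0r.
- by move=> *; rewrite scale1r.
- by move=> *; rewrite scalerDr.
- by move=> *; rewrite scalerDl.
- by move=> m m' n; rewrite (linear_funD _ _ (fl n)).
- by move=> m n n'; rewrite (linear_funD _ _ (fr m)).
- by move=> c m n; rewrite (linear_funZ _ _ (fl n)).
- by move=> c m n; rewrite (linear_funZ _ _ (fr m)).
Qed.

Lemma tlift_class f s : is_bilinear f -> tlift f (tclass s) = teval f s.
Proof. by move=> bf; apply: teval_eq (tclassK s). Qed.

Lemma tliftE f m n : is_bilinear f -> tlift f (pure m n) = f m n.
Proof. by move=> bf; rewrite tlift_class. Qed.

Lemma tlift_linear f : is_bilinear f -> linear (tlift f).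
Proof.
move=> bf c x y; have [s ->] := tclass_surj x; have [t ->] := tclass_surj y.
have -> : c *: tclass s + tclass t = tclass (t_add (t_scale c s) t).
  by rewrite -[LHS]/(tadd (tscale c _) _) tscaleE taddE.
by rewrite !tlift_class.
Qed.

Lemma tlift_unique f (g : tens -> W) : is_bilinear f -> linear g ->
  (forall m n, g (pure m n) = f m n) -> g =1 tlift f.
Proof.
move=> bf lg gf x; have lt := tlift_linear bf.
elim/tens_ind: x => [m n||x y gx gy|c x gx].
- by rewrite gf tliftE.
- by rewrite !linear_fun0.
- by rewrite !linear_funD // gx gy.
- by rewrite !linear_funZ // gx.
Qed.

End Lift.
End TensorProduct.

Notation "m ⊗ n" := (pure m n) (at level 40, left associativity) : ring_scope.

Section TensorTheory.
Variable k : fieldType.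
Implicit Types M N P V W : lmodType k.

Lemma linear_comp V W P (f : W -> P) (g : V -> W) :
  linear f -> linear g -> linear (fun v => f (g v)).
Proof. by move=> lf lg c u v; rewrite lg lf. Qed.

Lemma linear_id V : linear (fun v : V => v). Proof. by []. Qed.

Lemma tens_ext M N W (f g : tens M N -> W) : linear f -> linear g ->
  (forall m n, f (m ⊗ n) = g (m ⊗ n)) -> f =1 g.
Proof.
move=> lf lg fg x; elim/tens_ind: x => [//||x y fx fy|c x fx].
- by rewrite !linear_fun0.
- by rewrite !linear_funD // fx fy.
- by rewrite !linear_funZ // fx.
Qed.

Lemma tlift_param_linear M N V W (F : V -> M -> N -> W) x :
  (forall m n, linear (fun v => F v m n)) ->
  linear (fun v => tlift (F v) x).
Proof.
move=> lF c u v; have [s ->] := tclass_surj x; rewrite /tlift.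
elim: (tterm_of _) => {s} [m n||s Hs t Ht|d s Hs] /=.
- exact: lF.
- by rewrite scaler0 addr0.
- by rewrite Hs Ht scalerDr addrACA.
- by rewrite Hs scalerDr !scalerA mulrC.
Qed.

Definition is_trilinear M N P W (f : M -> N -> P -> W) : Prop :=
  [/\ forall n p, linear (fun m => f m n p),
      forall m p, linear (fun n => f m n p) &
      forall m n, linear (f m n)].

Definition tlift3 M N P W (f : M -> N -> P -> W) : tens (tens M N) P -> W :=
  tlift (fun s p => tlift (fun m n => f m n p) s).

Lemma tlift3_bilinear M N P W (f : M -> N -> P -> W) : is_trilinear f ->
  is_bilinear (fun s p => tlift (fun m n => f m n p) s).
Proof.
move=> [f1 f2 f3]; split=> [p|s]; first exact: tlift_linear.
exact: tlift_param_linear.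
Qed.

Lemma tlift3_linear M N P W (f : M -> N -> P -> W) :
  is_trilinear f -> linear (tlift3 f).
Proof. by move=> tf; apply/tlift_linear/tlift3_bilinear. Qed.

Lemma tlift3E M N P W (f : M -> N -> P -> W) m n p : is_trilinear f ->
  tlift3 f (m ⊗ n ⊗ p) = f m n p.
Proof.
move=> tf; rewrite /tlift3 tliftE; last exact: tlift3_bilinear.
by rewrite tliftE //; case: tf => f1 f2 f3; split.
Qed.

Lemma tlift3_param_linear M N P V W (F : V -> M -> N -> P -> W) x :
  (forall m n p, linear (fun v => F v m n p)) ->
  linear (fun v => tlift3 (F v) x).
Proof.
by move=> lF; apply: tlift_param_linear => s p; apply: tlift_param_linear.
Qed.

Lemma tens_ext3 M N P W (f g : tens (tens M N) P -> W) : linear f -> linear g ->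
  (forall m n p, f (m ⊗ n ⊗ p) = g (m ⊗ n ⊗ p)) -> f =1 g.
Proof.
move=> lf lg fg; apply: tens_ext => // s p.
have lp h : linear h -> linear (fun s : tens M N => h (s ⊗ p) : W).
  by move=> lh; apply: linear_comp lh (pure_linearl _).
exact: (tens_ext (lp f lf) (lp g lg) (fun m n => fg m n p)).
Qed.

Lemma ex_functional V (e : V) : e != 0 ->
  exists f : V -> k^o, linear f /\ f e = 1.
Proof.
move=> e0.
pose Q (X : set V) := (forall c u v, X u -> X v -> X (c *: u + v)) /\ ~ X e.
have [F FQ Ftot|W [[WL We] Wmax]] := @Zorn_bigcup V Q.
  split=> [c u v [X FX Xu] [Y FY Yv]|[X FX Xe]]; last by case: (FQ X FX).
  have [XY|YX] := Ftot X Y FX FY.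
    by exists Y => //; apply: (FQ Y FY).1 => //; apply: XY.
  by exists X => //; apply: (FQ X FX).1 => //; apply: YX.
have W0 : W 0.
  apply: contrapT => nW0.
  have W_0 u : ~ W u.
    by move=> Wu; apply: nW0; rewrite -[0](subrr u) addrC -scaleN1r; apply: WL.
  apply: (Wmax (set1 0)).
    by split=> [u /W_0 //|] H; apply: nW0; apply: H.
  split=> [c u v -> ->|/eqP]; first by rewrite scaler0 addr0.
  by rewrite (negPf e0).
have dec x : exists c, W (x - c *: e).
  have [Wx|nWx] := pselect (W x); first by exists 0; rewrite scale0r subr0.
  pose X := [set y | exists c, W (y - c *: x)]%classic.
  have XW : (W `<` X)%classic.
    split=> [u Wu|/(_ x)]; first by exists 0; rewrite scale0r subr0.
    by move=> /(_ _)/nWx; apply; exists 1; rewrite scale1r subrr.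
  have [c Wc] : X e.
    apply: contrapT => nXe; apply: Wmax XW _; split=> // c u v [a Wa] [b Wb].
    exists (c * a + b).
    have := WL c _ _ Wa Wb.
    by rewrite scalerBr scalerA addrACA -opprD -scalerDl.
  have [c0|c0] := eqVneq c 0; first by rewrite c0 scale0r subr0 in Wc.
  exists c^-1; have := WL (- c^-1) _ _ Wc W0.
  by rewrite addr0 scalerBr !scaleNr opprK scalerA mulVf // scale1r addrC.
have decU x c d : W (x - c *: e) -> W (x - d *: e) -> c = d.
  move=> Wc Wd; apply: contrapT => /eqP; rewrite eq_sym -subr_eq0 => cd.
  have := WL (-1) _ _ Wd Wc.
  rewrite scaleN1r opprB addrA subrK -scalerBl => W1.
  by have := WL (d - c)^-1 _ _ W1 W0; rewrite addr0 scalerA mulVf // scale1r.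
pose f x : k^o := projT1 (cid (dec x)).
have fP x : W (x - f x *: e) by rewrite /f; case: (cid _).
exists f; split=> [c u v|].
  apply: (decU (c *: u + v)); first exact: fP.
  have := WL c _ _ (fP u) (fP v).
  by rewrite scalerBr scalerA addrACA -opprD -scalerDl.
by apply: (decU e); [exact: fP|rewrite scale1r subrr].
Qed.

Lemma pure_neq0 M N (m : M) (n : N) : m != 0 -> n != 0 -> m ⊗ n != 0.
Proof.
move=> /ex_functional[f [lf fm]] /ex_functional[g [lg gn]]; apply/eqP => mn0.
have bf : is_bilinear (fun m n => f m * g n : k^o).
  split=> [y|x] c u v; first by rewrite lf mulrDl -scalerAl.
  by rewrite lg mulrDr -scalerAr.
have := congr1 (tlift (fun m n => f m * g n : k^o)) mn0.
rewrite (tliftE _ _ bf) fm gn mulr1 (linear_fun0 (tlift_linear bf)).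
by move/eqP; rewrite oner_eq0.
Qed.

End TensorTheory.

(* The tensor product of algebras: (a (x) b)(a' (x) b') = aa' (x) bb'. *)
Section TensorAlgebra.
Variables (k : fieldType) (A B : algType k).
Local Notation T := (tens A B).

Definition tmul (x y : T) : T :=
  tlift (fun a b => tlift (fun a' b' => (a * a') ⊗ (b * b')) y) x.

Fact tmul_bilinear1 (a : A) (b : B) :
  is_bilinear (fun a' b' => (a * a') ⊗ (b * b') : T).
Proof.
split=> [b'|a'] c u v; first by rewrite mulrDr -scalerAr pure_linearl.
by rewrite mulrDr -scalerAr pure_linearr.
Qed.

Fact tmul_bilinear2 y :
  is_bilinear (fun a b => tlift (fun a' b' => (a * a') ⊗ (b * b') : T) y).
Proof.
split=> [b|a].
  apply: tlift_param_linear => m n c u v.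
  by rewrite mulrDl -scalerAl pure_linearl.
apply: tlift_param_linear => m n c u v.
by rewrite mulrDl -scalerAl pure_linearr.
Qed.

Lemma tmul_pure a b a' b' : tmul (a ⊗ b) (a' ⊗ b') = (a * a') ⊗ (b * b').
Proof.
rewrite /tmul (tliftE _ _ (tmul_bilinear2 _)).
by rewrite (tliftE _ _ (tmul_bilinear1 _ _)).
Qed.

Fact tmul_linearl y : linear (tmul^~ y).
Proof. exact: (tlift_linear (tmul_bilinear2 y)). Qed.

Fact tmul_linearr x : linear (tmul x).
Proof.
apply: tlift_param_linear => a b; exact: (tlift_linear (tmul_bilinear1 a b)).
Qed.

Fact tmulA : associative tmul.
Proof.
move=> x y z; move: x; apply: tens_ext.
- exact: tmul_linearl.
- exact: linear_comp (tmul_linearl z) (tmul_linearl y).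
move=> a b; move: y; apply: tens_ext.
- exact: linear_comp (tmul_linearr _) (tmul_linearl z).
- exact: linear_comp (tmul_linearl z) (tmul_linearr _).
move=> a' b'; move: z; apply: tens_ext.
- exact: linear_comp (tmul_linearr _) (tmul_linearr _).
- exact: tmul_linearr.
by move=> a'' b''; rewrite !tmul_pure !mulrA.
Qed.

Fact tmul1 : left_id (1 ⊗ 1) tmul.
Proof.
apply: tens_ext; [exact: tmul_linearr|exact: linear_id|].
by move=> a b; rewrite tmul_pure !mul1r.
Qed.

Fact tmulr1 : right_id (1 ⊗ 1) tmul.
Proof.
apply: tens_ext; [exact: tmul_linearl|exact: linear_id|].
by move=> a b; rewrite tmul_pure !mulr1.
Qed.

Fact tmulDl : left_distributive tmul +%R.
Proof. by move=> x y z; apply: (linear_funD _ _ (tmul_linearl z)). Qed.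

Fact tmulDr : right_distributive tmul +%R.
Proof. by move=> x y z; apply: (linear_funD _ _ (tmul_linearr x)). Qed.

Fact tone_neq0 : (1 : A) ⊗ (1 : B) != 0.
Proof. by apply: pure_neq0; apply: oner_neq0. Qed.

HB.instance Definition _ := GRing.Zmodule_isNzRing.Build T
  tmulA tmul1 tmulr1 tmulDl tmulDr tone_neq0.

Fact tscalerAl (c : k) (x y : T) : c *: (x * y) = (c *: x) * y.
Proof. by rewrite [RHS](linear_funZ _ _ (tmul_linearl y)). Qed.
HB.instance Definition _ := GRing.Lmodule_isLalgebra.Build k T tscalerAl.
Fact tscalerAr (c : k) (x y : T) : c *: (x * y) = x * (c *: y).
Proof. by rewrite [RHS](linear_funZ _ _ (tmul_linearr x)). Qed.
HB.instance Definition _ := GRing.Lalgebra_isAlgebra.Build k T tscalerAr.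

Lemma tens_mulE a b a' b' :
  (a ⊗ b : T) * (a' ⊗ b') = (a * a') ⊗ (b * b').
Proof. exact: tmul_pure. Qed.

Lemma tens_oneE : 1 = 1 ⊗ 1 :> T. Proof. by []. Qed.

End TensorAlgebra.

Section Opposite.
Variables (k : fieldType) (A : algType k).

HB.instance Definition _ := GRing.Lmodule.copy A^c A.
Fact opp_scalerAl (c : k) (x y : A^c) :
  @GRing.scale k A^c c (@GRing.mul A^c x y) = @GRing.mul A^c (c *: x) y.
Proof. exact: (@scalerAr k A c y x). Qed.
HB.instance Definition _ := GRing.Lmodule_isLalgebra.Build k A^c opp_scalerAl.
Fact opp_scalerAr (c : k) (x y : A^c) :
  @GRing.scale k A^c c (@GRing.mul A^c x y) = @GRing.mul A^c x (c *: y).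
Proof. exact: (@scalerAl k A c y x). Qed.
HB.instance Definition _ := GRing.Lalgebra_isAlgebra.Build k A^c opp_scalerAr.

(* a^o, the element a of A seen in the opposite algebra [A^c]. *)
Definition opel (a : A) : A^c := a.

Definition Aenv := tens A A^c.
HB.instance Definition _ := GRing.Algebra.on Aenv.

End Opposite.

(* U_k(L): the k-algebra generated by [u_gen x], x in L, subject to linearity
   of [u_gen] and [x, y] = xy - yx. *)
Section Enveloping.
Variables (k : fieldType) (L : lieAlgType k).

Inductive uterm :=
| u_gen of L
| u_zero
| u_one
| u_add of uterm & uterm
| u_mul of uterm & uterm
| u_scale of k & uterm.

Inductive ueq : uterm -> uterm -> Prop :=
| ueq_refl s : ueq s s
| ueq_sym s t : ueq s t -> ueq t s
| ueq_trans s t u : ueq s t -> ueq t u -> ueq s u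
| ueq_add s s' t t' : ueq s s' -> ueq t t' -> ueq (u_add s t) (u_add s' t')
| ueq_mul s s' t t' : ueq s s' -> ueq t t' -> ueq (u_mul s t) (u_mul s' t')
| ueq_scale c s s' : ueq s s' -> ueq (u_scale c s) (u_scale c s')
| ueq_addA s t u : ueq (u_add s (u_add t u)) (u_add (u_add s t) u)
| ueq_addC s t : ueq (u_add s t) (u_add t s)
| ueq_add0 s : ueq (u_add u_zero s) s
| ueq_scaleA c d s : ueq (u_scale c (u_scale d s)) (u_scale (c * d) s)
| ueq_scale0 s : ueq (u_scale 0 s) u_zero
| ueq_scale1 s : ueq (u_scale 1 s) s
| ueq_scaleDr c s t :
    ueq (u_scale c (u_add s t)) (u_add (u_scale c s) (u_scale c t))
| ueq_scaleDl c d s :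
    ueq (u_scale (c + d) s) (u_add (u_scale c s) (u_scale d s))
| ueq_mulA s t u : ueq (u_mul s (u_mul t u)) (u_mul (u_mul s t) u)
| ueq_mul1 s : ueq (u_mul u_one s) s
| ueq_mulr1 s : ueq (u_mul s u_one) s
| ueq_mulDl s t u : ueq (u_mul (u_add s t) u) (u_add (u_mul s u) (u_mul t u))
| ueq_mulDr s t u : ueq (u_mul s (u_add t u)) (u_add (u_mul s t) (u_mul s u))
| ueq_scaleAl c s t : ueq (u_scale c (u_mul s t)) (u_mul (u_scale c s) t)
| ueq_scaleAr c s t : ueq (u_scale c (u_mul s t)) (u_mul s (u_scale c t))
| ueq_genD x y : ueq (u_gen (x + y)) (u_add (u_gen x) (u_gen y))
| ueq_genZ c x : ueq (u_gen (c *: x)) (u_scale c (u_gen x))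
| ueq_lie x y : ueq (u_gen (lie x y))
    (u_add (u_mul (u_gen x) (u_gen y))
           (u_scale (-1) (u_mul (u_gen y) (u_gen x)))).

HB.instance Definition _ := gen_eqMixin uterm.
HB.instance Definition _ := gen_choiceMixin uterm.

Definition ueqb (s t : uterm) : bool := `[< ueq s t >].

Fact ueqb_refl : reflexive ueqb.
Proof. by move=> s; apply/asboolP; constructor. Qed.
Fact ueqb_sym : symmetric ueqb.
Proof. by move=> s t; apply/asboolP/asboolP => /ueq_sym. Qed.
Fact ueqb_trans : transitive ueqb.
Proof.
by move=> t s u /asboolP st /asboolP tu; apply/asboolP; apply: ueq_trans st tu.
Qed.

Canonical ueqb_equiv := EquivRel ueqb ueqb_refl ueqb_sym ueqb_trans.

Definition uenv := {eq_quot ueqb}%qT.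
HB.instance Definition _ := Choice.on uenv.

Definition uclass (s : uterm) : uenv := \pi_uenv%qT s.
Definition uterm_of (x : uenv) : uterm := repr x.

Lemma uterm_ofK x : uclass (uterm_of x) = x.
Proof. exact: reprK. Qed.

Lemma uclassP s t : uclass s = uclass t <-> ueq s t.
Proof.
split; first by move/eqmodP/asboolP.
by move=> st; apply/eqmodP/asboolP.
Qed.

Lemma uclassK s : ueq (uterm_of (uclass s)) s.
Proof. by apply/uclassP; rewrite uterm_ofK. Qed.

Definition uzero : uenv := uclass u_zero.
Definition uone : uenv := uclass u_one.
Definition uadd (x y : uenv) := uclass (u_add (uterm_of x) (uterm_of y)).
Definition umul (x y : uenv) := uclass (u_mul (uterm_of x) (uterm_of y)).
Definition uscale c (x : uenv) := uclass (u_scale c (uterm_of x)).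

Lemma uaddE s t : uadd (uclass s) (uclass t) = uclass (u_add s t).
Proof. by apply/uclassP; apply: ueq_add; apply: uclassK. Qed.
Lemma umulE s t : umul (uclass s) (uclass t) = uclass (u_mul s t).
Proof. by apply/uclassP; apply: ueq_mul; apply: uclassK. Qed.
Lemma uscaleE c s : uscale c (uclass s) = uclass (u_scale c s).
Proof. by apply/uclassP; apply: ueq_scale; apply: uclassK. Qed.

Lemma uclass_surj x : exists s, x = uclass s.
Proof. by exists (uterm_of x); rewrite uterm_ofK. Qed.

Fact uaddA : associative uadd.
Proof.
move=> x y z; have [s ->] := uclass_surj x; have [t ->] := uclass_surj y.
have [u ->] := uclass_surj z; rewrite !uaddE; apply/uclassP.
exact: ueq_addA.
Qed.
Fact uaddC : commutative uadd.
Proof.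
move=> x y; have [s ->] := uclass_surj x; have [t ->] := uclass_surj y.
by rewrite !uaddE; apply/uclassP; apply: ueq_addC.
Qed.
Fact uadd0 : left_id uzero uadd.
Proof.
move=> x; have [s ->] := uclass_surj x.
by rewrite !uaddE; apply/uclassP; apply: ueq_add0.
Qed.
HB.instance Definition _ := GRing.isNmodule.Build uenv uaddA uaddC uadd0.

Fact uscaleA c d x : uscale c (uscale d x) = uscale (c * d) x.
Proof.
have [s ->] := uclass_surj x.
by rewrite !uscaleE; apply/uclassP; apply: ueq_scaleA.
Qed.
Fact uscale0 x : uscale 0 x = 0.
Proof.
have [s ->] := uclass_surj x.
by rewrite !uscaleE; apply/uclassP; apply: ueq_scale0.
Qed.
Fact uscale1 : left_id 1 uscale.
Proof.
move=> x; have [s ->] := uclass_surj x.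
by rewrite !uscaleE; apply/uclassP; apply: ueq_scale1.
Qed.
Fact uscaleDr : right_distributive uscale +%R.
Proof.
move=> c x y; have [s ->] := uclass_surj x; have [t ->] := uclass_surj y.
rewrite /GRing.add /= !(uaddE, uscaleE); apply/uclassP; exact: ueq_scaleDr.
Qed.
Fact uscaleDl x : {morph uscale^~ x : c d / c + d}.
Proof.
move=> c d; have [s ->] := uclass_surj x.
rewrite /GRing.add /= !(uaddE, uscaleE); apply/uclassP; exact: ueq_scaleDl.
Qed.

HB.instance Definition _ := GRing.Nmodule_isLSemiModule.Build k uenv
  uscaleA uscale0 uscale1 uscaleDr uscaleDl.
HB.instance Definition _ := GRing.LSemiModule_isLmodule.Build k uenv.

Section Eval.
Variables (R : algType k) (f : L -> R).

Fixpoint ueval (s : uterm) : R :=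
  match s with
  | u_gen x => f x
  | u_zero => 0
  | u_one => 1
  | u_add s t => ueval s + ueval t
  | u_mul s t => ueval s * ueval t
  | u_scale c s => c *: ueval s
  end.

Lemma ueval_eq s t : linear f -> (forall x y, f (lie x y) = commutator (f x) (f y)) ->
  ueq s t -> ueval s = ueval t.
Proof.
move=> lf mf; elim=> //=.
- by move=> ? ? ? _ -> _ ->.
- by move=> ? ? ? ? _ -> _ ->.
- by move=> ? ? ? ? _ -> _ ->.
- by move=> ? ? ? _ ->.
- by move=> *; rewrite addrA.
- by move=> *; rewrite addrC.
- by move=> *; rewrite add0r.
- by move=> *; rewrite scalerA.
- by move=> *; rewrite scale0r.
- by move=> *; rewrite scale1r.
- by move=> *; rewrite scalerDr.
- by move=> *; rewrite scalerDl.
- by move=> *; rewrite mulrA.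
- by move=> *; rewrite mul1r.
- by move=> *; rewrite mulr1.
- by move=> *; rewrite mulrDl.
- by move=> *; rewrite mulrDr.
- by move=> *; rewrite scalerAl.
- by move=> *; rewrite scalerAr.
- by move=> x y; rewrite linear_funD.
- by move=> c x; rewrite linear_funZ.
- by move=> x y; rewrite mf scaleN1r.
Qed.
End Eval.

Fact uone_neq0 : uone != 0.
Proof.
apply/eqP => /uclassP e10.
have : (1 : k^o) = 0.
  apply: (ueval_eq (R := k^o) (f := fun=> 0) _ _ e10) => [c x y|x y].
    by rewrite scaler0 addr0.
  by rewrite /commutator mulr0 subrr.
by move/eqP; rewrite oner_eq0.
Qed.

Fact umulA : associative umul.
Proof.
move=> x y z; have [s ->] := uclass_surj x; have [t ->] := uclass_surj y.
have [u ->] := uclass_surj z; rewrite !umulE; apply/uclassP.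
exact: ueq_mulA.
Qed.
Fact umul1 : left_id uone umul.
Proof.
move=> x; have [s ->] := uclass_surj x.
by rewrite !umulE; apply/uclassP; apply: ueq_mul1.
Qed.
Fact umulr1 : right_id uone umul.
Proof.
move=> x; have [s ->] := uclass_surj x.
by rewrite !umulE; apply/uclassP; apply: ueq_mulr1.
Qed.
Fact umulDl : left_distributive umul +%R.
Proof.
move=> x y z; have [s ->] := uclass_surj x; have [t ->] := uclass_surj y.
have [u ->] := uclass_surj z; rewrite /GRing.add /= !(uaddE, umulE).
by apply/uclassP; apply: ueq_mulDl.
Qed.
Fact umulDr : right_distributive umul +%R.
Proof.
move=> x y z; have [s ->] := uclass_surj x; have [t ->] := uclass_surj y.
have [u ->] := uclass_surj z; rewrite /GRing.add /= !(uaddE, umulE).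
by apply/uclassP; apply: ueq_mulDr.
Qed.

HB.instance Definition _ := GRing.Zmodule_isNzRing.Build uenv
  umulA umul1 umulr1 umulDl umulDr uone_neq0.

Fact uscaleAl (c : k) (x y : uenv) : c *: (x * y) = (c *: x) * y.
Proof.
have [s ->] := uclass_surj x; have [t ->] := uclass_surj y.
rewrite /GRing.scale /GRing.mul /= !(uscaleE, umulE).
by apply/uclassP; apply: ueq_scaleAl.
Qed.
HB.instance Definition _ := GRing.Lmodule_isLalgebra.Build k uenv uscaleAl.
Fact uscaleAr (c : k) (x y : uenv) : c *: (x * y) = x * (c *: y).
Proof.
have [s ->] := uclass_surj x; have [t ->] := uclass_surj y.
rewrite /GRing.scale /GRing.mul /= !(uscaleE, umulE).
by apply/uclassP; apply: ueq_scaleAr.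
Qed.
HB.instance Definition _ := GRing.Lalgebra_isAlgebra.Build k uenv uscaleAr.

Definition ugen (x : L) : uenv := uclass (u_gen x).

Lemma ugen_linear : linear ugen.
Proof.
move=> c x y; have -> : c *: ugen x + ugen y =
    uclass (u_add (u_scale c (u_gen x)) (u_gen y)).
  by rewrite -[LHS]/(uadd (uscale c _) _) uscaleE uaddE.
apply/uclassP; apply: ueq_trans (ueq_genD _ _) _.
by apply: ueq_add (ueq_refl _); apply: ueq_genZ.
Qed.

Lemma ugen_lie x y : ugen (lie x y) = commutator (ugen x) (ugen y).
Proof.
rewrite /commutator -scaleN1r.
have -> : ugen x * ugen y + -1 *: (ugen y * ugen x) = uclass
    (u_add (u_mul (u_gen x) (u_gen y))
       (u_scale (-1) (u_mul (u_gen y) (u_gen x)))).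
  by rewrite -[LHS]/(uadd (umul _ _) (uscale _ (umul _ _))) !umulE uscaleE uaddE.
by apply/uclassP; apply: ueq_lie.
Qed.

Lemma uenv_ind (P : uenv -> Prop) :
  P 1 -> P 0 -> (forall u v, P u -> P v -> P (u + v)) ->
  (forall c u, P u -> P (c *: u)) ->
  (forall x u, P u -> P (ugen x * u)) -> forall u, P u.
Proof.
move=> P1 P0 Pa Ps Pm.
suff H s v : P v -> P (uclass s * v).
  by move=> u; have [s ->] := uclass_surj u; rewrite -[_ s]mulr1; apply: H.
elim: s v => [x||| s Hs t Ht|s Hs t Ht|c s Hs] v Pv.
- exact: Pm.
- by rewrite -[uclass _]/(0 : uenv) mul0r.
- by rewrite -[uclass _]/(1 : uenv) mul1r.
- by rewrite -uaddE -[uadd _ _]/(uclass s + uclass t) mulrDl; apply: Pa; [apply: Hs|apply: Ht].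
- by rewrite -umulE -[umul _ _]/(uclass s * uclass t) -mulrA; apply/Hs/Ht.
- by rewrite -uscaleE -[uscale _ _]/(c *: uclass s) -scalerAl; apply/Ps/Hs.
Qed.

End Enveloping.

HB.instance Definition _ (k : fieldType) (L : lieAlgType k) :=
  GRing.isLinear.Build k L (comm_lie (uenv L)) *:%R (@ugen k L)
    (@ugen_linear k L).
HB.instance Definition _ (k : fieldType) (L : lieAlgType k) :=
  isLieMorphism.Build k L (comm_lie (uenv L)) (@ugen k L) (@ugen_lie k L).

Section EnvelopingLift.
Variables (k : fieldType) (L : lieAlgType k) (R : algType k).
Variable f : {liemorph L -> comm_lie R}.

Fact liemorph_linear : linear (f : L -> R).
Proof. exact: (linearP f). Qed.
Fact liemorph_commutator x y :
  (f : L -> R) (lie x y) = commutator (f x : R) (f y : R).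
Proof. exact: (lie_morph (s := f) x y). Qed.

Definition ulift (u : uenv L) : R := ueval f (uterm_of u).

Lemma ulift_class s : ulift (uclass s) = ueval f s.
Proof.
apply: ueval_eq (uclassK s); [exact: liemorph_linear|exact: liemorph_commutator].
Qed.

Lemma uliftE x : ulift (ugen x) = f x.
Proof. exact: ulift_class. Qed.

Fact ulift_linear : linear ulift.
Proof.
move=> c x y; have [s ->] := uclass_surj x; have [t ->] := uclass_surj y.
have -> : c *: uclass s + uclass t = uclass (u_add (u_scale c s) t).
  by rewrite -[LHS]/(uadd (uscale c _) _) uscaleE uaddE.
by rewrite !ulift_class.
Qed.

Fact ulift_monoid : monoid_morphism ulift.
Proof.
split; first exact: (ulift_class (u_one L)).
move=> x y; have [s ->] := uclass_surj x; have [t ->] := uclass_surj y.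
by rewrite -[_ * _]/(umul _ _) umulE !ulift_class.
Qed.

HB.instance Definition _ :=
  GRing.isLinear.Build k (uenv L) R *:%R ulift ulift_linear.
HB.instance Definition _ :=
  GRing.isMonoidMorphism.Build (uenv L) R ulift ulift_monoid.

Lemma ulift_unique (g : {lrmorphism uenv L -> R}) :
  (forall x, g (ugen x) = f x) -> g =1 ulift.
Proof.
move=> gf; apply: uenv_ind => [||u v gu gv|c u gu|x u gu].
- by rewrite !rmorph1.
- by rewrite !raddf0.
- by rewrite (linear_funD _ _ ulift_linear) -gu -gv; apply: (raddfD g).
- by rewrite (linear_funZ _ _ ulift_linear) -gu; apply: (linearZ_LR g).
- by rewrite (ulift_monoid.2 _ _) uliftE -gf -gu; apply: (rmorphM g).
Qed.

End EnvelopingLift.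

Section Multilinear.
Variable k : fieldType.
Implicit Types (V M N P : lmodType k) (R : algType k).

Lemma linear_pure1 V M N (f : V -> M) (n : N) :
  linear f -> linear (fun v => f v ⊗ n).
Proof. exact: linear_comp (pure_linearl n). Qed.

Lemma linear_pure2 V M N (f : V -> N) (m : M) :
  linear f -> linear (fun v => m ⊗ f v).
Proof. exact: linear_comp (pure_linearr m). Qed.

Lemma linear_mul1 V R (f : V -> R) (b : R) :
  linear f -> linear (fun v => f v * b).
Proof. by move=> lf c u v; rewrite lf mulrDl -scalerAl. Qed.

Lemma linear_mul2 V R (f : V -> R) (b : R) :
  linear f -> linear (fun v => b * f v).
Proof. by move=> lf c u v; rewrite lf mulrDr -scalerAr. Qed.

Lemma linear_add V M (f g : V -> M) :
  linear f -> linear g -> linear (fun v => f v + g v).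
Proof. by move=> lf lg c u v; rewrite lf lg scalerDr addrACA. Qed.

End Multilinear.

Section Coproduct.
Variables (k : fieldType) (L : lieAlgType k).
Local Notation U := (uenv L).

Definition uprim (x : L) : comm_lie (tens U U) := ugen x ⊗ 1 + 1 ⊗ ugen x.

Fact uprim_linear : linear uprim.
Proof.
apply: linear_add; first exact: linear_pure1 (@ugen_linear k L).
exact: linear_pure2 (@ugen_linear k L).
Qed.
HB.instance Definition _ := GRing.isLinear.Build k L (comm_lie (tens U U)) *:%R
  uprim uprim_linear.

Fact uprim_lie x y : uprim (lie x y) = lie (uprim x) (uprim y).
Proof.
rewrite -[RHS]/(commutator (_ : tens U U) _) /commutator /uprim.
rewrite !mulrDl !mulrDr !tens_mulE !(mulr1, mul1r) !ugen_lie /commutator.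
have subl (a b : U) : (a - b) ⊗ (1 : U) = a ⊗ 1 - b ⊗ 1.
  by rewrite addrC -scaleN1r pure_linearl scaleN1r addrC.
have subr (a b : U) : (1 : U) ⊗ (a - b) = 1 ⊗ a - 1 ⊗ b.
  by rewrite addrC -scaleN1r pure_linearr scaleN1r addrC.
rewrite subl subr !opprD !addrA.
rewrite [RHS](ACl ((1*5)*(4*8)*((2*7)*(3*6)))) /=.
by rewrite !subrr !addr0 !addrA.
Qed.
HB.instance Definition _ := isLieMorphism.Build k L (comm_lie (tens U U))
  uprim uprim_lie.

(* Delta, the algebra morphism with Delta(x) = x (x) 1 + 1 (x) x on L. *)
Definition ucomul : uenv L -> tens U U := ulift uprim.
HB.instance Definition _ := GRing.LRMorphism.on ucomul.

Lemma ucomul_gen x : ucomul (ugen x) = ugen x ⊗ 1 + 1 ⊗ ugen x.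
Proof. exact: uliftE. Qed.

(* (Delta (x) id) o Delta : u |-> sum u_(1) (x) u_(2) (x) u_(3). *)
Definition ucomul2 (u : U) : tens (tens U U) U :=
  tlift (fun v w => ucomul v ⊗ w) (ucomul u).

Lemma ucomul_linear : linear ucomul. Proof. exact: linearP. Qed.

Fact ucomul2_bilinear : is_bilinear (fun v w : U => ucomul v ⊗ w).
Proof.
split=> [w|v]; first exact: linear_pure1 ucomul_linear.
exact: pure_linearr.
Qed.

Lemma ucomul2_linear : linear ucomul2.
Proof. exact: linear_comp (tlift_linear ucomul2_bilinear) ucomul_linear. Qed.

Lemma ucomul2_1 : ucomul2 1 = 1 ⊗ 1 ⊗ 1.
Proof.
rewrite /ucomul2 rmorph1 [1 in LHS]tens_oneE (tliftE _ _ ucomul2_bilinear).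
by rewrite rmorph1.
Qed.

Lemma ucomul2M u v : ucomul2 (u * v) = ucomul2 u * ucomul2 v.
Proof.
rewrite /ucomul2 rmorphM /=.
have lT := tlift_linear ucomul2_bilinear.
move: (ucomul u) (ucomul v) => p q.
move: p; apply: tens_ext; [|exact: linear_mul1 lT|move=> a b].
  exact: linear_comp lT (linear_mul1 q (@linear_id _ _)).
move: q; apply: tens_ext; [|exact: linear_mul2 lT|move=> a' b'].
  exact: linear_comp lT (linear_mul2 _ (@linear_id _ _)).
by rewrite tens_mulE !(tliftE _ _ ucomul2_bilinear) tens_mulE rmorphM.
Qed.

Lemma ucomul2_gen x : ucomul2 (ugen x) =
  ugen x ⊗ 1 ⊗ 1 + 1 ⊗ ugen x ⊗ 1 + 1 ⊗ 1 ⊗ ugen x.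
Proof.
rewrite /ucomul2 ucomul_gen (linear_funD _ _ (tlift_linear ucomul2_bilinear)).
rewrite !(tliftE _ _ ucomul2_bilinear) ucomul_gen rmorph1.
by rewrite (linear_funD _ _ (pure_linearl _)).
Qed.

End Coproduct.

Section Action.
Variables (k : fieldType) (A : algType k) (L : lieAlgType k).
Variable w : {liemorph L -> Der A}.

Definition anchor_End (x : L) : comm_lie (kEnd A) := Der_End (w x).

Fact anchor_End_linear : linear anchor_End.
Proof.
move=> c x y; apply: kEnd_ext => a.
by rewrite -[LHS]/(w (c *: x + y) a) linearP.
Qed.
HB.instance Definition _ := GRing.isLinear.Build k L (comm_lie (kEnd A)) *:%R
  anchor_End anchor_End_linear.

Fact anchor_End_lie x y :
  anchor_End (lie x y) = lie (anchor_End x) (anchor_End y).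
Proof.
by apply: kEnd_ext => a; rewrite -[LHS]/(w (lie x y) a) lie_morph.
Qed.
HB.instance Definition _ := isLieMorphism.Build k L (comm_lie (kEnd A))
  anchor_End anchor_End_lie.

Definition Omega : uenv L -> kEnd A := ulift anchor_End.
HB.instance Definition _ := GRing.LRMorphism.on Omega.

Definition uact (u : uenv L) (a : A) : A := Omega u a.

Lemma uact_gen x a : uact (ugen x) a = w x a.
Proof. by rewrite /uact /Omega uliftE. Qed.

Lemma uact1 a : uact 1 a = a.
Proof. by rewrite /uact rmorph1. Qed.

Lemma uactM u v a : uact (u * v) a = uact u (uact v a).
Proof. by rewrite /uact rmorphM. Qed.

Lemma uact_linear u : linear (uact u).
Proof. exact: kEnd_linear. Qed.

Lemma uact_linearl a : linear (uact^~ a).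
Proof. by move=> c u v; rewrite /uact linearP. Qed.

Lemma linear_uact1 (V : lmodType k) (f : V -> uenv L) a :
  linear f -> linear (fun v => uact (f v) a).
Proof. exact: linear_comp (uact_linearl a). Qed.

Lemma linear_uact2 (V : lmodType k) (f : V -> A) u :
  linear f -> linear (fun v => uact u (f v)).
Proof. exact: linear_comp (uact_linear u). Qed.

Lemma linear_Der (V : lmodType k) (f : V -> A) (D : Der A) :
  linear f -> linear (fun v => D (f v)).
Proof. by apply: linear_comp; exact: linearP. Qed.

End Action.

Ltac multilin := rewrite /=; repeat first
  [ exact: linear_id | apply: linear_pure1 | apply: linear_pure2
  | apply: linear_mul1 | apply: linear_mul2
  | apply: linear_uact1 | apply: linear_uact2 | apply: linear_Der
  | apply: linear_add ].

Section BL.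
Variables (k : fieldType) (A : algType k) (L : lieAlgType k).
Local Notation U := (uenv L).

(* The anchor occurs in the type because the product depends on it. *)
Definition BL (w : {liemorph L -> Der A}) : Type := tens (tens A U) A.
HB.instance Definition _ w := GRing.Lmodule.copy (BL w) (tens (tens A U) A).

Variable w : {liemorph L -> Der A}.
Local Notation B := (BL w).


Definition btens (a : A) (u : U) (b : A) : B := a ⊗ u ⊗ b.

(* Sweedler's sum over u_(1) (x) u_(2) (x) u_(3) is a linear map applied to
   [ucomul2 u]. *)
Definition bmul_pure (a : A) (u : U) (b a' : A) (v : U) (b' : A) : B :=
  tlift3 (fun u1 u2 u3 : U =>
            btens (a * uact w u1 a') (u2 * v) (uact w u3 b' * b))
    (ucomul2 u).

Definition bmul (x y : B) : B :=
  tlift3 (fun a u b => tlift3 (fun a' v b' => bmul_pure a u b a' v b') y) x.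

Definition bone : B := btens 1 1 1.

Fact bmul_pure_trilinear0 a b a' v b' :
  is_trilinear (fun u1 u2 u3 : U =>
     btens (a * uact w u1 a') (u2 * v) (uact w u3 b' * b)).
Proof. by split=> *; rewrite /btens; multilin. Qed.

Fact bmul_pure_linear u :
  [/\ forall b a' v b', linear (fun a => bmul_pure a u b a' v b'),
      forall a a' v b', linear (fun b => bmul_pure a u b a' v b'),
      forall a b v b', linear (fun a' => bmul_pure a u b a' v b'),
      forall a b a' b', linear (fun v => bmul_pure a u b a' v b') &
      forall a b a' v, linear (fun b' => bmul_pure a u b a' v b')].
Proof.
by split=> * ; apply: tlift3_param_linear => *; rewrite /btens; multilin.
Qed.

Fact bmul_pure_linearu a b a' v b' :
  linear (fun u => bmul_pure a u b a' v b').
Proof.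
exact: linear_comp (tlift3_linear (bmul_pure_trilinear0 _ _ _ _ _))
  (@ucomul2_linear k L).
Qed.

Fact bmul_trilinear1 a u b :
  is_trilinear (fun a' v b' => bmul_pure a u b a' v b').
Proof. by case: (bmul_pure_linear u) => H1 H2 H3 H4 H5; split. Qed.

Fact bmul_trilinear2 y :
  is_trilinear (fun a u b => tlift3 (fun a' v b' => bmul_pure a u b a' v b') y).
Proof.
split=> [u b|a b|a u]; apply: tlift3_param_linear => a' v b'.
- by case: (bmul_pure_linear u).
- exact: bmul_pure_linearu.
- by case: (bmul_pure_linear u).
Qed.

Lemma bmulE a u b a' v b' :
  bmul (btens a u b) (btens a' v b') = bmul_pure a u b a' v b'.
Proof.
rewrite /bmul (tlift3E _ _ _ (bmul_trilinear2 _)).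
by rewrite (tlift3E _ _ _ (bmul_trilinear1 _ _ _)).
Qed.

Lemma bmul_linearl y : linear (bmul^~ y).
Proof. exact: (tlift3_linear (bmul_trilinear2 y)). Qed.

Lemma bmul_linearr x : linear (bmul x).
Proof.
apply: tlift3_param_linear => a u b.
exact: (tlift3_linear (bmul_trilinear1 a u b)).
Qed.

(* The left A^e-action and the derivation by x in L, through which left
   multiplications factor. *)
Let amod (a b : A) : B -> B := tlift3 (fun a' v b' => btens (a * a') v (b' * b)).
Let bder (x : L) : B -> B := tlift3 (fun a' v b' =>
  btens (w x a') v b' + btens a' (ugen x * v) b' + btens a' v (w x b')).

Let amod_tri a b : is_trilinear (fun a' v b' => btens (a * a') v (b' * b)).
Proof. by split=> *; rewrite /btens; multilin. Qed.
Let bder_tri x : is_trilinear (fun a' v b' =>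
  btens (w x a') v b' + btens a' (ugen x * v) b' + btens a' v (w x b')).
Proof. by split=> *; rewrite /btens; multilin. Qed.

Let amodE a b a' v b' : amod a b (btens a' v b') = btens (a * a') v (b' * b).
Proof. exact: tlift3E (amod_tri a b). Qed.
Let bderE x a v b : bder x (btens a v b) =
  btens (w x a) v b + btens a (ugen x * v) b + btens a v (w x b).
Proof. exact: tlift3E (bder_tri x). Qed.
Let amod_linear a b : linear (amod a b).
Proof. exact: tlift3_linear (amod_tri a b). Qed.
Let bder_linear x : linear (bder x).
Proof. exact: tlift3_linear (bder_tri x). Qed.

Let BL_ext (W : lmodType k) (f g : B -> W) : linear f -> linear g ->
  (forall a v b, f (btens a v b) = g (btens a v b)) -> f =1 g.
Proof. exact: tens_ext3. Qed.

Let BLlin (f g : B -> B) : linear f -> linear g -> linear (fun x => f (g x)).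
Proof. exact: linear_comp. Qed.

Let bmul_amod1 a u b y :
  bmul (btens a u b) y = amod a b (bmul (btens 1 u 1) y).
Proof.
move: y; apply: BL_ext; [exact: bmul_linearr| |move=> a' v b'].
  exact: BLlin (amod_linear _ _) (bmul_linearr _).
rewrite !bmulE /bmul_pure; move: (ucomul2 u); apply: tens_ext3.
- exact: tlift3_linear (bmul_pure_trilinear0 _ _ _ _ _).
- exact: linear_comp (amod_linear _ _)
    (tlift3_linear (bmul_pure_trilinear0 _ _ _ _ _)).
move=> u1 u2 u3; rewrite !(tlift3E _ _ _ (bmul_pure_trilinear0 _ _ _ _ _)).
by rewrite amodE mul1r mulr1.
Qed.

Let bmul_gen x u y :
  bmul (btens 1 (ugen x * u) 1) y = bder x (bmul (btens 1 u 1) y).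
Proof.
move: y; apply: BL_ext; [exact: bmul_linearr| |move=> a' v b'].
  exact: BLlin (bder_linear _) (bmul_linearr _).
rewrite !bmulE /bmul_pure ucomul2M ucomul2_gen.
have lF := tlift3_linear (bmul_pure_trilinear0 1 1 a' v b').
move: (ucomul2 u); apply: tens_ext3.
- by apply: linear_comp lF _; multilin.
- exact: linear_comp (bder_linear _) lF.
move=> u1 u2 u3; rewrite !mulrDl !tens_mulE !mul1r !(linear_funD _ _ lF).
rewrite !(tlift3E _ _ _ (bmul_pure_trilinear0 _ _ _ _ _)).
by rewrite !mul1r !mulr1 bderE !uactM !uact_gen mulrA.
Qed.

Let bmul1 y : bmul bone y = y.
Proof.
move: y; apply: BL_ext; [exact: bmul_linearr|exact: linear_id|move=> a v b].
rewrite bmulE /bmul_pure ucomul2_1.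
rewrite (tlift3E _ _ _ (bmul_pure_trilinear0 _ _ _ _ _)).
by rewrite !uact1 !mul1r mulr1.
Qed.

Let bder_amod x a b y : bder x (amod a b y) =
  amod (w x a) b y + amod a b (bder x y) + amod a (w x b) y.
Proof.
move: y; apply: BL_ext => [||a' v b'].
- exact: BLlin (bder_linear _) (amod_linear _ _).
- apply: linear_add; last exact: amod_linear.
  apply: linear_add; first exact: amod_linear.
  exact: BLlin (amod_linear _ _) (bder_linear _).
rewrite !(amodE, bderE) !(linear_funD _ _ (amod_linear _ _)) !amodE !DerM.
have addl (c d : A) z e : btens (c + d) z e = btens c z e + btens d z e.
  by apply: (linear_funD c d (f := fun c => btens c z e)); rewrite /btens; multilin.
have addr (c d : A) z e : btens e z (c + d) = btens e z c + btens e z d.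
  by apply: (linear_funD c d (f := fun c => btens e z c)); rewrite /btens; multilin.
by rewrite addl addr -!addrA.
Qed.

Let bmul_amod a b x y : bmul (amod a b x) y = amod a b (bmul x y).
Proof.
move: x; apply: BL_ext => [||a' v b'].
- exact: BLlin (bmul_linearl _) (amod_linear _ _).
- exact: BLlin (amod_linear _ _) (bmul_linearl _).
rewrite amodE bmul_amod1 [in RHS]bmul_amod1.
move: (bmul _ y); apply: BL_ext => [||c z d].
- exact: amod_linear.
- exact: BLlin (amod_linear _ _) (amod_linear _ _).
by rewrite !amodE !mulrA.
Qed.

Let bmul_bder x y z : bmul (bder x y) z = bder x (bmul y z).
Proof.
move: y; apply: BL_ext => [||a v b].
- exact: BLlin (bmul_linearl _) (bder_linear _).
- exact: BLlin (bder_linear _) (bmul_linearl _).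
rewrite bderE !(linear_funD _ _ (bmul_linearl _)).
rewrite (bmul_amod1 _ (ugen x * v)) bmul_gen.
rewrite (bmul_amod1 (w x a)) (bmul_amod1 a v (w x b)) (bmul_amod1 a v b).
by rewrite bder_amod.
Qed.

Let bmulA : associative bmul.
Proof.
move=> x y z; apply: esym; move: x; apply: BL_ext => [||a u b].
- exact: BLlin (bmul_linearl _) (bmul_linearl _).
- exact: bmul_linearl.
rewrite bmul_amod1 bmul_amod [RHS]bmul_amod1; congr amod.
have lu (t : B) : linear (fun u => bmul (btens 1 u 1) t).
  by apply: linear_comp (bmul_linearl t) _; rewrite /btens; multilin.
have lu' : linear (fun u => bmul (bmul (btens 1 u 1) y) z).
  exact: linear_comp (bmul_linearl z) (lu y).
elim/uenv_ind: u => [||u v Hu Hv|c u Hu|x u Hu].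
- by rewrite !bmul1.
- by rewrite (linear_fun0 lu') (linear_fun0 (lu _)).
- by rewrite (linear_funD _ _ lu') (linear_funD _ _ (lu _)) Hu Hv.
- by rewrite (linear_funZ _ _ lu') (linear_funZ _ _ (lu _)) Hu.
- by rewrite !bmul_gen bmul_bder Hu.
Qed.

Let bmulr1 : right_id bone bmul.
Proof.
apply: BL_ext; [exact: bmul_linearl|exact: linear_id|move=> a u b].
suff -> : bmul (btens a u b) bone = amod a b (btens 1 u 1).
  by rewrite amodE mulr1 mul1r.
rewrite bmul_amod1; congr amod.
have lb : linear (fun u => btens 1 u 1) by rewrite /btens; multilin.
have lu : linear (fun u => bmul (btens 1 u 1) bone).
  exact: linear_comp (bmul_linearl _) lb.
elim/uenv_ind: u => [||u v Hu Hv|c u Hu|x u Hu].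
- exact: bmul1.
- by rewrite (linear_fun0 lu) (linear_fun0 lb).
- by rewrite (linear_funD _ _ lu) (linear_funD _ _ lb) Hu Hv.
- by rewrite (linear_funZ _ _ lu) (linear_funZ _ _ lb) Hu.
rewrite bmul_gen Hu bderE Der1 /btens.
rewrite (linear_fun0 (pure_linearr _)).
rewrite (linear_fun0 (pure_linearl _)) (linear_fun0 (pure_linearl _)).
by rewrite add0r addr0.
Qed.

Let bmulDl : left_distributive bmul +%R.
Proof. by move=> x y z; apply: (linear_funD _ _ (bmul_linearl z)). Qed.

Let bmulDr : right_distributive bmul +%R.
Proof. by move=> x y z; apply: (linear_funD _ _ (bmul_linearr x)). Qed.

Let bone_neq0 : bone != 0.
Proof. by apply: pure_neq0; [apply: pure_neq0|]; apply: oner_neq0. Qed.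

HB.instance Definition _ := GRing.Zmodule_isNzRing.Build B
  bmulA bmul1 bmulr1 bmulDl bmulDr bone_neq0.

Let bscalerAl (c : k) (x y : B) :
  @GRing.scale k B c (@GRing.mul B x y) = @GRing.mul B (c *: x) y.
Proof. exact: esym (linear_funZ c x (bmul_linearl y)). Qed.
HB.instance Definition _ := GRing.Lmodule_isLalgebra.Build k B bscalerAl.
Let bscalerAr (c : k) (x y : B) :
  @GRing.scale k B c (@GRing.mul B x y) = @GRing.mul B x (c *: y).
Proof. exact: esym (linear_funZ c y (bmul_linearr x)). Qed.
HB.instance Definition _ := GRing.Lalgebra_isAlgebra.Build k B bscalerAr.

Lemma BL_mulE a u b a' v b' :
  btens a u b * btens a' v b' = bmul_pure a u b a' v b'.
Proof. exact: bmulE. Qed.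

Lemma BL_oneE : 1 = btens 1 1 1 :> B. Proof. by []. Qed.

Lemma BL_mul1E a b a' v b' :
  btens a 1 b * btens a' v b' = btens (a * a') v (b' * b).
Proof.
rewrite BL_mulE /bmul_pure ucomul2_1.
rewrite (tlift3E _ _ _ (bmul_pure_trilinear0 _ _ _ _ _)).
by rewrite !uact1 mul1r.
Qed.

Definition BJ (x : L) : comm_lie B := btens 1 (ugen x) 1.

Fact BJ_linear : linear BJ.
Proof.
have lb : linear (fun u => btens 1 u 1) by rewrite /btens; multilin.
exact: linear_comp lb (@ugen_linear k L).
Qed.
HB.instance Definition _ := GRing.isLinear.Build k L (comm_lie B) *:%R
  BJ BJ_linear.

Let BJM x u : btens 1 (ugen x) 1 * btens 1 u 1 = btens 1 (ugen x * u) 1.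
Proof.
rewrite -[ugen x in LHS]mulr1 -[LHS]/(bmul _ _) bmul_gen bmul1 bderE Der1 /btens.
rewrite (linear_fun0 (pure_linearr _)).
rewrite (linear_fun0 (pure_linearl _)) (linear_fun0 (pure_linearl _)).
by rewrite add0r addr0.
Qed.

Fact BJ_lie x y : BJ (lie x y) = lie (BJ x) (BJ y).
Proof.
rewrite -[RHS]/(commutator (_ : B) _) /commutator /BJ !BJM ugen_lie.
have lb : linear (fun u => btens 1 u 1) by rewrite /btens; multilin.
rewrite /commutator addrC -scaleN1r lb scaleN1r.
by rewrite addrC.
Qed.
HB.instance Definition _ := isLieMorphism.Build k L (comm_lie B) BJ BJ_lie.

Definition Benv : Aenv A -> B :=
  tlift (fun (a : A) (b : A^c) => btens a 1 (b : A)).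

Fact Benv_bilinear : is_bilinear (fun (a : A) (b : A^c) => btens a 1 (b : A)).
Proof.
split=> [b|a]; first by rewrite /btens; multilin.
exact: (pure_linearr (a ⊗ 1)).
Qed.

Lemma BenvE a b : Benv (a ⊗ opel b) = btens a 1 b.
Proof. exact: tliftE Benv_bilinear. Qed.

Fact Benv_linear : linear Benv.
Proof. exact: tlift_linear Benv_bilinear. Qed.

Fact Benv_monoid : monoid_morphism Benv.
Proof.
split=> [|x y]; first exact: (BenvE 1 1).
move: x; apply: tens_ext => [||a b].
- by apply: linear_comp Benv_linear _; multilin.
- by apply: linear_mul1; exact: Benv_linear.
move: y; apply: tens_ext => [||a' b'].
- by apply: linear_comp Benv_linear _; multilin.
- by apply: linear_mul2; exact: Benv_linear.
by rewrite tens_mulE !(BenvE _ _) BL_mul1E.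
Qed.

HB.instance Definition _ :=
  GRing.isLinear.Build k (Aenv A) B *:%R Benv Benv_linear.
HB.instance Definition _ :=
  GRing.isMonoidMorphism.Build (Aenv A) B Benv Benv_monoid.

End BL.

Record envRing (k : fieldType) (A : algType k) := EnvRing {
  envRing_alg :> algType k;
  envRing_map : {lrmorphism Aenv A -> envRing_alg}
}.

Definition is_envRing_morphism (k : fieldType) (A : algType k)
    (R S : envRing A) (f : {lrmorphism R -> S}) : Prop :=
  forall t : Aenv A, f (envRing_map R t) = envRing_map S t.

Definition BLring (k : fieldType) (A : algType k) (L : lieAlgType k)
    (w : {liemorph L -> Der A}) : envRing A :=
  EnvRing (Benv w).

(* Main.v *)
(** [B_L] is generated by the images of [A^e] and [L]: one has
    a ⊗ u ⊗ b = (a ⊗ 1 ⊗ b)(1 ⊗ u ⊗ 1), and left multiplication by J_L(X) acts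
    on [A ⊗ U(L) ⊗ A] by the Leibniz rule. Hence uniqueness is immediate, and
    the linear map a ⊗ u ⊗ b ↦ φ_A(a ⊗ b^o) φ'(u) is multiplicative as soon as
    it intertwines left multiplication by the two kinds of generators; for X
    in [L] this is exactly the commutation hypothesis. *)

From HB Require Import structures.
Require Import Defs.
From mathcomp Require Import all_boot all_algebra.

Set Implicit Arguments.
Unset Strict Implicit.
Unset Printing Implicit Defensive.

Import GRing.Theory.
Local Open Scope ring_scope.

Section BLTheory.
Variables (k : fieldType) (A : algType k) (L : lieAlgType k).
Variable w : {liemorph L -> Der A}.
Local Notation B := (BL w).
Local Notation bt := (btens w).

Lemma btens_linear_mid a b : linear (fun u => bt a u b).
Proof. by rewrite /btens; multilin. Qed.

Lemma BL_ext (W : lmodType k) (f g : B -> W) : linear f -> linear g ->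
  (forall a u b, f (bt a u b) = g (bt a u b)) -> f =1 g.
Proof. exact: tens_ext3. Qed.

(** A primitive element has an iterated coproduct of three terms ([ucomul2_gen]), with [ugen x] in
    one slot and [1] in the other two; each gives one Leibniz term. *)
Lemma BJ_mulE x a v b : (BJ w x : B) * bt a v b =
  bt (w x a) v b + bt a (ugen x * v) b + bt a v (w x b).
Proof.
rewrite /BJ BL_mulE /bmul_pure ucomul2_gen.
have lF := tlift3_linear (bmul_pure_trilinear0 w 1 1 a v b).
rewrite !(linear_funD _ _ lF).
rewrite !(tlift3E _ _ _ (bmul_pure_trilinear0 _ _ _ _ _ _)).
by rewrite !uact1 !uact_gen !mul1r !mulr1.
Qed.

(** Derivations kill [1], so only the middle Leibniz term survives. This drives the inductions on
    [u] below. *)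
Lemma btens_gen_mul x u : bt 1 (ugen x * u) 1 = (BJ w x : B) * bt 1 u 1.
Proof.
rewrite BJ_mulE !Der1 /btens.
rewrite (linear_fun0 (pure_linearr _)) (linear_fun0 (pure_linearl _)).
by rewrite (linear_fun0 (pure_linearl _)) add0r addr0.
Qed.

Lemma btens_factor a u b : bt a u b = bt a 1 b * bt 1 u 1.
Proof. by rewrite BL_mul1E mulr1 mul1r. Qed.

Section Lift.
Variables (R : envRing A) (phiL : {liemorph L -> comm_lie R}).
Local Notation e := (envRing_map R).

Definition BLift (x : B) : R :=
  tlift3 (fun a u b => e (a ⊗ opel b) * ulift phiL u) x.

Fact BLift_trilinear :
  is_trilinear (fun a u b => e (a ⊗ opel b) * ulift phiL u).
Proof.
split=> [u b|a b|a u].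
- apply: linear_mul1; apply: linear_comp (linearP e) _.
  exact: pure_linearl.
- exact: linear_mul2 (ulift_linear phiL).
- apply: linear_mul1; apply: linear_comp (linearP e) _.
  exact: (pure_linearr (a : A) (N := A^c)).
Qed.

Lemma BLiftE a u b : BLift (bt a u b) = e (a ⊗ opel b) * ulift phiL u.
Proof. exact: tlift3E BLift_trilinear. Qed.

Fact BLift_linear : linear BLift.
Proof. exact: tlift3_linear BLift_trilinear. Qed.

Lemma BLift_env_mul a b y : BLift (bt a 1 b * y) = e (a ⊗ opel b) * BLift y.
Proof.
move: y; apply: BL_ext => [||a' v b'].
- exact: linear_comp BLift_linear (linear_mul2 _ (@linear_id _ _)).
- exact: linear_mul2 BLift_linear.
rewrite BL_mul1E !BLiftE mulrA -rmorphM; congr (e _ * _).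
(* The reversed product [b' * b] in [A] is [opel b * opel b'] in [A^c]. *)
exact: esym (tens_mulE _ (opel b) _ (opel b')).
Qed.

Lemma BLift_unique (Psi : {lrmorphism BLring w -> R}) :
  is_envRing_morphism Psi -> (forall X, Psi (BJ w X) = phiL X) ->
  Psi =1 BLift.
Proof.
move=> Pe PL; apply: BL_ext => [||a u b]; first exact: linearP.
  exact: BLift_linear.
have lPsi : linear (fun u => Psi (bt 1 u 1)).
  exact: linear_comp (linearP Psi) (btens_linear_mid 1 1).
have lU := ulift_linear phiL.
(* By [btens_factor] only the middle factor is left: the other one lies in the image of [Benv],
   where [Pe] fixes [Psi]. *)
suff Hu : Psi (bt 1 u 1) = ulift phiL u.
  rewrite BLiftE btens_factor -Pe -[envRing_map _ _]/(Benv w _) BenvE -Hu.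
  exact: (rmorphM Psi).
elim/uenv_ind: u => [||u v Hu Hv|c u Hu|x u Hu].
- by rewrite [LHS](rmorph1 Psi) rmorph1.
- by rewrite (linear_fun0 lPsi) (linear_fun0 lU).
- by rewrite (linear_funD _ _ lPsi) (linear_funD _ _ lU) Hu Hv.
- by rewrite (linear_funZ _ _ lPsi) (linear_funZ _ _ lU) Hu.
- rewrite btens_gen_mul (rmorphM (ulift phiL)) /= uliftE -PL -Hu.
  exact: (rmorphM Psi).
Qed.

Hypothesis hphi : forall (a b : A) (X : L),
  lie (phiL X) (e (a ⊗ opel b) : comm_lie R) =
    e (w X a ⊗ opel b + a ⊗ opel (w X b)).

Lemma BLift_BJ_mul x y : BLift ((BJ w x : B) * y) = (phiL x : R) * BLift y.
Proof.
move: y; apply: BL_ext => [||a v b].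
- exact: linear_comp BLift_linear (linear_mul2 _ (@linear_id _ _)).
- exact: linear_mul2 BLift_linear.
(* The commutation hypothesis, read as a rule for moving [phiL x] to the right past [e]; its three
   terms match those of [BJ_mulE]. *)
have he : (phiL x : R) * e (a ⊗ opel b) =
    e (a ⊗ opel b) * (phiL x : R) + e (w x a ⊗ opel b)
      + e (a ⊗ opel (w x b)).
  have eD s t : e (s + t) = e s + e t := raddfD e s t.
  rewrite -addrA -eD -hphi -[lie _ _]/(commutator (_ : R) _).
  by rewrite /commutator addrC subrK.
rewrite BJ_mulE !(linear_funD _ _ BLift_linear) !BLiftE rmorphM /= uliftE.
by rewrite !mulrA he !mulrDl (addrC (e (w x a ⊗ _) * _)).
Qed.

(** Generators are peeled off [u] one at a time; [BLift_BJ_mul] is applied to the element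
    [bt 1 u 1 * y]. *)
Lemma BLift_mid_mul u y : BLift (bt 1 u 1 * y) = ulift phiL u * BLift y.
Proof.
have lB : linear (fun u => BLift (bt 1 u 1 * y)).
  exact: linear_comp BLift_linear (linear_mul1 y (btens_linear_mid 1 1)).
have lU := linear_mul1 (BLift y) (ulift_linear phiL).
elim/uenv_ind: u => [||u v Hu Hv|c u Hu|x u Hu].
- by rewrite rmorph1 -BL_oneE !mul1r.
- by rewrite (linear_fun0 lB) (linear_fun0 lU).
- by rewrite (linear_funD _ _ lB) (linear_funD _ _ lU) Hu Hv.
- by rewrite (linear_funZ _ _ lB) (linear_funZ _ _ lU) Hu.
- by rewrite btens_gen_mul -mulrA BLift_BJ_mul Hu rmorphM /= uliftE mulrA.
Qed.

Fact BLift_monoid : monoid_morphism BLift.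
Proof.
split=> [|x y]; first by rewrite BL_oneE BLiftE !rmorph1 mulr1.
move: x; apply: BL_ext => [||a u b].
- exact: linear_comp BLift_linear (linear_mul1 _ (@linear_id _ _)).
- exact: linear_mul1 BLift_linear.
(* Associativity in [B] lets the two factors of [bt a u b] leave [BLift] in turn. *)
by rewrite BLiftE btens_factor -mulrA BLift_env_mul BLift_mid_mul mulrA.
Qed.

End Lift.
End BLTheory.

Theorem theorem2p9 (k : fieldType) (hk : [pchar k] =i pred0) (A : algType k)
    (L : lieAlgType k) (w : {liemorph L -> Der A})
    (R : envRing A) (phiL : {liemorph L -> comm_lie R})
    (hphi : forall (a b : A) (X : L),
      lie (phiL X) (envRing_map R (a ⊗ opel b) : comm_lie R) =
        envRing_map R (w X a ⊗ opel b + a ⊗ opel (w X b))) :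
  exists Phi : {lrmorphism BLring w -> R},
    [/\ is_envRing_morphism Phi,
        forall X : L, Phi (BJ w X) = phiL X,
        forall Psi : {lrmorphism BLring w -> R},
          is_envRing_morphism Psi -> (forall X : L, Psi (BJ w X) = phiL X) ->
          Psi =1 Phi
      & exists phi' : {lrmorphism uenv L -> R},
          [/\ forall X : L, phi' (ugen X) = phiL X,
              forall psi' : {lrmorphism uenv L -> R},
                (forall X : L, psi' (ugen X) = phiL X) -> psi' =1 phi'
            & forall (a b : A) (u : uenv L),
                Phi (btens w a u b) = envRing_map R (a ⊗ opel b) * phi' u]].
Proof.
(* Multiplicativity depends on [hphi], so the morphism structure is packed locally. *)
pose F : BLring w -> R := BLift phiL.
pose FL := GRing.isLinear.Build k (BLring w) R *:%R F (BLift_linear phiL).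
pose FM := GRing.isMonoidMorphism.Build (BLring w) R F (BLift_monoid hphi).
pose Phi : {lrmorphism BLring w -> R} := HB.pack F FL FM.
exists Phi; split=> [t|X|Psi|].
(* On pure tensors this is the explicit formula at [u = 1]. *)
- move: t; apply: tens_ext => [||a b].
  + exact: linear_comp (linearP Phi) (linearP (Benv w)).
  + exact: linearP.
  rewrite -[LHS]/(BLift phiL (Benv w (a ⊗ opel b))) BenvE BLiftE.
  by rewrite rmorph1 mulr1.
- rewrite -[LHS]/(BLift phiL (btens w 1 (ugen X) 1)) BLiftE uliftE.
  by rewrite (rmorph1 (envRing_map R)) mul1r.
- exact: BLift_unique.
exists (ulift phiL); split=> [X|psi'|a b u].
- exact: uliftE.
- exact: ulift_unique.
- exact: BLiftE.
Qed.
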